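(* Let $w_{\mathrm d}=\operatorname{col}(\theta_{\mathrm d},\psi_{\mathrm d})\in(\mathbb R^{m+p})^T$ be any identifiable time series generated by an underlying discrete-time LTI system $$x(t+1)=Ax(t)+Bu(t),\qquad y(t)=Cx(t)+Du(t),$$ with $u=\operatorname{col}(u_1,u_2)$, $y=\operatorname{col}(y_1,y_2)$, and conformable partitions $$B=\begin{bmatrix}B_1&B_2\end{bmatrix},\quad C=\begin{bmatrix}C_1 \\ C_2\end{bmatrix},\quad D=\begin{bmatrix}D_{11}&D_{12} \\ D_{21}&D_{22}\end{bmatrix},$$ according to one of the six relations (Relation 1 to Relation 6) between $\theta$ and $\psi$ listed in the context. Suppose that $D_{11}\neq 0$, $D_{22}\neq 0$, and neither $[C_1,\,D_{11},\,D_{12}]$ nor $[C_2,\,D_{21},\,D_{22}]$ has full row rank. Then the BeCaus test applied to $w_{\mathrm d}$ always leads to a correct result; that is, the truth values of the four conditions ①, ②, ③, ④ of the BeCaus test are exactly those in the row of the BeCaus table corresponding to the relation according to which $w_{\mathrm d}$ was generated.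
   Context: **Notation.** $\operatorname{col}(a,b)=[a^\top,b^\top]^\top$. For a matrix or vector $H$, $H_{[i,j]}$ is the submatrix of rows $i$ through $j$ (inclusive). For a time series $w=(w(1),\dots,w(T))$ with $w(t)\in\mathbb R^r$, the depth-$L$ Hankel matrix is $$\mathscr H_L(w)=\begin{pmatrix}w(1)&\cdots&w(T-L+1)\\ \vdots&&\vdots\\ w(L)&\cdots&w(T)\end{pmatrix}.$$ **Systems.** The underlying system with matrices $A,B,C,D$ of proper (real) dimensions defines the behavior $\mathscr B$ consisting of all trajectories $\operatorname{col}(u,y)\in(\mathbb R^q)^{\mathbb Z_{\ge0}}$ for which there is a state trajectory $x$ satisfying $x(t+1)=Ax(t)+Bu(t)$, $y(t)=Cx(t)+Du(t)$ for all $t$. The input dimension is $k$ and the output dimension is $q-k$. The order $n$ is the smallest state dimension among all input/state/output representations of $\mathscr B$. The lag $\ell$ is the smallest positive integer such that the observability matrix $\operatorname{col}(C,CA,\dots,CA^{\ell-1})$ has rank $n$. $\mathscr B_T$ is the set of length-$T$ sequences $w$ for which there is $v\in\mathscr B$ with $w(t)=v(t)$ for $1\le t\le T$. Trajectories are identified up to reordering of the signal components. **The six relations.** $\theta$ is $\mathbb R^m$-valued and $\psi$ is $\mathbb R^p$-valued; only $\theta_{\mathrm d},\psi_{\mathrm d}$ are observed, and $v$ denotes the latent (unobserved) signal. - Structure (I), Relation 1 (independence): $\theta=u_1$, $\psi=u_2$ are two free inputs, and the output $y$ of the system is the hidden signal $v$. - Structure (II), Relation 2 ($\theta\to\psi$):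 $\theta=u$, $\psi=y$. - Structure (II), Relation 3 ($\psi\to\theta$): $\psi=u$, $\theta=y$. - Structure (III), Relation 4 ($\theta,(v)\to\psi$): $\theta=u_1$, $v=u_2$, $\psi=y$. - Structure (III), Relation 5 ($\psi,(v)\to\theta$): $\psi=u_1$, $v=u_2$, $\theta=y$. - Structure (IV), Relation 6 ($(v)\to\theta,\psi$): $v=u$, $\theta=y_1$, $\psi=y_2$. **Identifiable time series.** Let $T_{\mathrm f}=2$. The data $w_{\mathrm d}=\operatorname{col}(\theta_{\mathrm d},\psi_{\mathrm d})$, collected from the system according to one of the six relations Relation 1 (independence), Relation 2 ($\theta\to\psi$), Relation 3 ($\psi\to\theta$), Relation 4 ($\theta,(v)\to\psi$), Relation 5 ($\psi,(v)\to\theta$), Relation 6 ($(v)\to\theta,\psi$), is identifiable if: (i) in Structures (I), (III), (IV): there exists $T_{\mathrm{ini}}>\ell$ such that $\operatorname{rank}\mathscr H_{T_{\mathrm{ini}}+T_{\mathrm f}}(\overline w_{\mathrm d})=k(T_{\mathrm{ini}}+T_{\mathrm f})+n$, where $\overline w_{\mathrm d}=\operatorname{col}(\theta_{\mathrm d},\psi_{\mathrm d},v_{\mathrm d})\in\mathscr B_T$ and $v_{\mathrm d}$ is the (uncollected) time series of the hidden variable $v$; (ii) in Structure (II): there exists $T_{\mathrm{ini}}>\ell$ such that $\operatorname{rank}\mathscr H_{T_{\mathrm{ini}}+T_{\mathrm f}}(w_{\mathrm d})=k(T_{\mathrm{ini}}+T_{\mathrm f})+n$, where $w_{\mathrm d}\in\mathscr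 B_T$. **BeCaus test.** Take $T_{\mathrm f}=2$ and $T_{\mathrm{ini}}>\ell$ as in the identifiability condition. Partition $$\begin{pmatrix}\Theta_{\mathrm p}\\ \Theta_{\mathrm f}\end{pmatrix}=\mathscr H_{T_{\mathrm{ini}}+2}(\theta_{\mathrm d}),\qquad \begin{pmatrix}\Psi_{\mathrm p}\\ \Psi_{\mathrm f}\end{pmatrix}=\mathscr H_{T_{\mathrm{ini}}+2}(\psi_{\mathrm d}),$$ where $\Theta_{\mathrm p}$ has $mT_{\mathrm{ini}}$ rows, $\Theta_{\mathrm f}$ has $2m$ rows, $\Psi_{\mathrm p}$ has $pT_{\mathrm{ini}}$ rows and $\Psi_{\mathrm f}$ has $2p$ rows. Let $\theta_{\mathrm{ini}},\psi_{\mathrm{ini}}$ be the first $T_{\mathrm{ini}}$ entries of $\theta_{\mathrm d},\psi_{\mathrm d}$ (stacked), and write $\theta_{\mathrm f}=\operatorname{col}(\theta_{\mathrm f}(1),\theta_{\mathrm f}(2))\in(\mathbb R^m)^2$, $\psi_{\mathrm f}=\operatorname{col}(\psi_{\mathrm f}(1),\psi_{\mathrm f}(2))\in(\mathbb R^p)^2$. Consider the equations, with $g\in\mathbb R^{T-T_{\mathrm{ini}}-1}$, $$(\mathrm E)\quad\begin{bmatrix}\Theta_{\mathrm p}\\ \Psi_{\mathrm p}\\ \Theta_{\mathrm f}\\ \Psi_{\mathrm f}\end{bmatrix}g=\begin{bmatrix}\theta_{\mathrm{ini}}\\ \psi_{\mathrm{ini}}\\ \theta_{\mathrm f}\\ \psi_{\mathrm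 f}\end{bmatrix},\qquad (\mathrm E')\quad\begin{bmatrix}\Theta_{\mathrm p}\\ \Psi_{\mathrm p}\\ (\Theta_{\mathrm f})_{[1,m]}\\ (\Psi_{\mathrm f})_{[1,p]}\end{bmatrix}g=\begin{bmatrix}\theta_{\mathrm{ini}}\\ \psi_{\mathrm{ini}}\\ \theta_{\mathrm f}(1)\\ \psi_{\mathrm f}(1)\end{bmatrix}.$$ The four conditions are: - ① For any $\theta_{\mathrm f}$, (E) yields a unique solution $\psi_{\mathrm f}$ (i.e. there is exactly one $\psi_{\mathrm f}$ for which some $g$ satisfies (E)). - ② For any $\psi_{\mathrm f}$, (E) yields a unique solution $\theta_{\mathrm f}$ (i.e. there is exactly one $\theta_{\mathrm f}$ for which some $g$ satisfies (E)). - ③ There exist $\theta_{\mathrm f}(1),\psi_{\mathrm f}(1),\psi_{\mathrm f}(2)$ such that (E'), with unknown $g$, has at least one solution, while (E), with unknowns $g$ and $\theta_{\mathrm f}(2)$, has no solution. - ④ There exist $\theta_{\mathrm f}(1),\psi_{\mathrm f}(1),\theta_{\mathrm f}(2)$ such that (E'), with unknown $g$, has at least one solution, while (E), with unknowns $g$ and $\psi_{\mathrm f}(2)$, has no solution. **BeCaus table** (inferred relation from truth values of (①,②,③,④); T = true, F = false): - (F,F,F,F): Relation 1 - (T,F,T,F): Relation 2 - (F,T,F,T): Relation 3 - (F,F,T,F): Relation 4 - (F,F,F,T): Relation 5 - (F,F,T,T): Relation 6 *)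

(* Defs.v *)
From HB Require Import structures.
From mathcomp Require Import all_boot all_order all_algebra reals.
Set Implicit Arguments.
Unset Strict Implicit.
Unset Printing Implicit Defensive.
Import Order.TTheory GRing.Theory Num.Theory.
Local Open Scope ring_scope.

Section Systems.
Context {R : realType}.

(* A trajectory w : Z_{>=0} -> R^(k + r) is read as col(u, y), with
   u t = usubmx (w t) and y t = dsubmx (w t). *)
Definition behavior (nx k r : nat) (A : 'M[R]_nx) (B : 'M[R]_(nx, k))
    (C : 'M[R]_(r, nx)) (D : 'M[R]_(r, k)) (w : nat -> 'cV[R]_(k + r)) : Prop :=
  exists x : nat -> 'cV[R]_nx, forall t,
    x t.+1 = A *m x t + B *m usubmx (w t) /\
    dsubmx (w t) = C *m x t + D *m usubmx (w t).

Definition representable (k r : nat) (beh : (nat -> 'cV[R]_(k + r)) -> Prop)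
    (nx : nat) : Prop :=
  exists (A : 'M[R]_nx) (B : 'M[R]_(nx, k)) (C : 'M[R]_(r, nx))
         (D : 'M[R]_(r, k)),
    forall w, beh w <-> behavior A B C D w.

Definition is_order (k r : nat) (beh : (nat -> 'cV[R]_(k + r)) -> Prop)
    (n : nat) : Prop :=
  representable beh n /\ forall n', representable beh n' -> (n <= n')%N.

Definition observability (nx r : nat) (A : 'M[R]_nx) (C : 'M[R]_(r, nx))
    (L : nat) : 'M[R]_(\sum_(i < L) r, nx) :=
  \mxcol_(i < L) (C *m A ^+ i).

Definition is_lag (nx r : nat) (A : 'M[R]_nx) (C : 'M[R]_(r, nx))
    (n l : nat) : Prop :=
  [/\ (0 < l)%N, \rank (observability A C l) = n
    & forall l', (0 < l')%N -> \rank (observability A C l') = n ->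
        (l <= l')%N].

End Systems.

Section Hankel.
Context {R : realType}.

(* Time series are tuples, so the sample w(t), t = 1, ..., T, is w`_(t - 1). *)

(* The number of columns is T.+1 - L rather than (T - L).+1, so that the
   matrix is empty, as it should be, when L > T. *)
Definition hankel_row (r T : nat) (w : T.-tuple 'cV[R]_r) (L i : nat) :
    'M[R]_(r, T.+1 - L) :=
  \matrix_(c < r, j < T.+1 - L) (w`_(i + j) c 0).

Definition hankel (r T : nat) (w : T.-tuple 'cV[R]_r) (L : nat) :
    'M[R]_(\sum_(i < L) r, T.+1 - L) :=
  \mxcol_(i < L) hankel_row w L i.

Definition hankel_past (r T : nat) (w : T.-tuple 'cV[R]_r) (Tini : nat) :
    'M[R]_(\sum_(i < Tini) r, T.+1 - (Tini + 2)) :=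
  \mxcol_(i < Tini) hankel_row w (Tini + 2) i.

Definition hankel_future (r T : nat) (w : T.-tuple 'cV[R]_r) (Tini : nat) :
    'M[R]_(r + r, T.+1 - (Tini + 2)) :=
  col_mx (hankel_row w (Tini + 2) Tini) (hankel_row w (Tini + 2) Tini.+1).

Definition initial (r T : nat) (w : T.-tuple 'cV[R]_r) (Tini : nat) :
    'cV[R]_(\sum_(i < Tini) r) :=
  \mxcol_(i < Tini) w`_i.

Definition join (r s T : nat) (w : T.-tuple 'cV[R]_r)
    (z : T.-tuple 'cV[R]_s) : T.-tuple 'cV[R]_(r + s) :=
  [tuple col_mx w`_i z`_i | i < T].

End Hankel.

Inductive relation :=
  | Rel1  (* theta and psi independent *)
  | Rel2  (* theta -> psi *)
  | Rel3  (* psi -> theta *)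
  | Rel4  (* theta, (v) -> psi *)
  | Rel5  (* psi, (v) -> theta *)
  | Rel6. (* (v) -> theta, psi *)

(* k1, k2, r1, r2 are the dimensions of u1, u2, y1, y2. *)

Definition theta_dim (rel : relation) (k1 k2 r1 r2 : nat) : nat :=
  match rel with
  | Rel1 => k1
  | Rel2 => k1 + k2
  | Rel3 => r1 + r2
  | Rel4 => k1
  | Rel5 => r1 + r2
  | Rel6 => r1
  end.

Definition psi_dim (rel : relation) (k1 k2 r1 r2 : nat) : nat :=
  match rel with
  | Rel1 => k2
  | Rel2 => r1 + r2
  | Rel3 => k1 + k2
  | Rel4 => r1 + r2
  | Rel5 => k1
  | Rel6 => r2
  end.

(* There is no hidden signal in Rel2 and Rel3. *)
Definition hidden_dim (rel : relation) (k1 k2 r1 r2 : nat) : nat :=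
  match rel with
  | Rel1 => r1 + r2
  | Rel2 => 0
  | Rel3 => 0
  | Rel4 => k2
  | Rel5 => k2
  | Rel6 => k1 + k2
  end.

Section Signals.
Context {R : realType} {k1 k2 r1 r2 : nat}.
Implicit Type w : 'cV[R]_((k1 + k2) + (r1 + r2)).

Definition sig_u w : 'cV[R]_(k1 + k2) := usubmx w.
Definition sig_u1 w : 'cV[R]_k1 := usubmx (sig_u w).
Definition sig_u2 w : 'cV[R]_k2 := dsubmx (sig_u w).
Definition sig_y w : 'cV[R]_(r1 + r2) := dsubmx w.
Definition sig_y1 w : 'cV[R]_r1 := usubmx (sig_y w).
Definition sig_y2 w : 'cV[R]_r2 := dsubmx (sig_y w).

Definition theta_of (rel : relation) w : 'cV[R]_(theta_dim rel k1 k2 r1 r2) :=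
  match rel with
  | Rel1 => sig_u1 w
  | Rel2 => sig_u w
  | Rel3 => sig_y w
  | Rel4 => sig_u1 w
  | Rel5 => sig_y w
  | Rel6 => sig_y1 w
  end.

Definition psi_of (rel : relation) w : 'cV[R]_(psi_dim rel k1 k2 r1 r2) :=
  match rel with
  | Rel1 => sig_u2 w
  | Rel2 => sig_y w
  | Rel3 => sig_u w
  | Rel4 => sig_y w
  | Rel5 => sig_u1 w
  | Rel6 => sig_y2 w
  end.

Definition hidden_of (rel : relation) w :
    'cV[R]_(hidden_dim rel k1 k2 r1 r2) :=
  match rel with
  | Rel1 => sig_y w
  | Rel2 => 0
  | Rel3 => 0
  | Rel4 => sig_u2 w
  | Rel5 => sig_u2 w
  | Rel6 => sig_u w
  end.

(* col(theta, psi, v) belongs to the restriction of beh to the times 1..T, up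
   to the reordering of signal components prescribed by rel.  Since
   behaviors start at time 0, the first sample is the value at time 1. *)
Definition in_restriction (rel : relation)
    (beh : (nat -> 'cV[R]_((k1 + k2) + (r1 + r2))) -> Prop) (T : nat)
    (th : T.-tuple 'cV[R]_(theta_dim rel k1 k2 r1 r2))
    (ps : T.-tuple 'cV[R]_(psi_dim rel k1 k2 r1 r2))
    (v : T.-tuple 'cV[R]_(hidden_dim rel k1 k2 r1 r2)) : Prop :=
  exists z, beh z /\ forall t, (t < T)%N ->
    [/\ th`_t = theta_of rel (z t.+1), ps`_t = psi_of rel (z t.+1)
      & v`_t = hidden_of rel (z t.+1)].

Definition full_rank_data (rel : relation) (T : nat)
    (th : T.-tuple 'cV[R]_(theta_dim rel k1 k2 r1 r2))
    (ps : T.-tuple 'cV[R]_(psi_dim rel k1 k2 r1 r2))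
    (v : T.-tuple 'cV[R]_(hidden_dim rel k1 k2 r1 r2)) (n L : nat) : Prop :=
  match rel with
  | Rel2 | Rel3 =>
      \rank (hankel (join th ps) L) = ((k1 + k2) * L + n)%N
  | _ =>
      \rank (hankel (join (join th ps) v) L) = ((k1 + k2) * L + n)%N
  end.

Arguments in_restriction rel beh {T} th ps v.
Arguments full_rank_data rel {T} th ps v n L.

(* Tini is a witness of the identifiability of col(th, ps), with horizon
   T_f = 2; n and l are the order and the lag of the system. *)
Definition identifiable_at (rel : relation)
    (beh : (nat -> 'cV[R]_((k1 + k2) + (r1 + r2))) -> Prop) (n l T : nat)
    (th : T.-tuple 'cV[R]_(theta_dim rel k1 k2 r1 r2))
    (ps : T.-tuple 'cV[R]_(psi_dim rel k1 k2 r1 r2)) (Tini : nat) : Prop :=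
  (l < Tini)%N /\
  exists v : T.-tuple 'cV[R]_(hidden_dim rel k1 k2 r1 r2),
    in_restriction rel beh th ps v /\ full_rank_data rel th ps v n (Tini + 2).

End Signals.

Arguments identifiable_at {R k1 k2 r1 r2} rel beh n l {T} th ps Tini.

Section Test.
Context {R : realType} {m p T : nat}.
Variables (th : T.-tuple 'cV[R]_m) (ps : T.-tuple 'cV[R]_p) (Tini : nat).

Definition eqE (g : 'cV[R]_(T.+1 - (Tini + 2)))
    (thf : 'cV[R]_(m + m)) (psf : 'cV[R]_(p + p)) : Prop :=
  col_mx (col_mx (hankel_past th Tini) (hankel_past ps Tini))
         (col_mx (hankel_future th Tini) (hankel_future ps Tini)) *m g
  = col_mx (col_mx (initial th Tini) (initial ps Tini)) (col_mx thf psf).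

Definition eqE' (g : 'cV[R]_(T.+1 - (Tini + 2)))
    (thf1 : 'cV[R]_m) (psf1 : 'cV[R]_p) : Prop :=
  col_mx (col_mx (hankel_past th Tini) (hankel_past ps Tini))
         (col_mx (usubmx (hankel_future th Tini))
                 (usubmx (hankel_future ps Tini))) *m g
  = col_mx (col_mx (initial th Tini) (initial ps Tini)) (col_mx thf1 psf1).

Definition cond1 : Prop := forall thf, exists! psf, exists g, eqE g thf psf.

Definition cond2 : Prop := forall psf, exists! thf, exists g, eqE g thf psf.

Definition cond3 : Prop := exists thf1 psf1 psf2,
  (exists g, eqE' g thf1 psf1) /\
  ~ (exists g thf2, eqE g (col_mx thf1 thf2) (col_mx psf1 psf2)).

Definition cond4 : Prop := exists thf1 psf1 thf2,
  (exists g, eqE' g thf1 psf1) /\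
  ~ (exists g psf2, eqE g (col_mx thf1 thf2) (col_mx psf1 psf2)).

End Test.

Definition becaus_table (rel : relation) : bool * bool * bool * bool :=
  match rel with
  | Rel1 => (false, false, false, false)
  | Rel2 => (true, false, true, false)
  | Rel3 => (false, true, false, true)
  | Rel4 => (false, false, true, false)
  | Rel5 => (false, false, false, true)
  | Rel6 => (false, false, true, true)
  end.

Definition becaus_correct {R : realType} {m p T : nat} (rel : relation)
    (th : T.-tuple 'cV[R]_m) (ps : T.-tuple 'cV[R]_p) (Tini : nat) : Prop :=
  let: (b1, b2, b3, b4) := becaus_table rel in
  [/\ cond1 th ps Tini <-> b1, cond2 th ps Tini <-> b2,
      cond3 th ps Tini <-> b3 & cond4 th ps Tini <-> b4].

(* Main.v *)
Require Import Defs.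
From HB Require Import structures.
From mathcomp Require Import all_boot all_order all_algebra reals.
Set Implicit Arguments.
Unset Strict Implicit.
Unset Printing Implicit Defensive.
Import Order.TTheory GRing.Theory Num.Theory.
Local Open Scope ring_scope.

(* The rank condition makes the columns of the Hankel matrix span the space of
   all windows of length Tini + 2, so that solving (E) amounts to finding a
   trajectory (arbitrary initial state and inputs) that starts with the recorded
   initial samples.  Each condition is then settled by the last sample alone:
   the last input can be prescribed freely, whereas an output, whose rows of
   [C D] are dependent, cannot take all values.  Uniqueness fails as soon as an
   unobserved input (or the other free input) acts on the signal; it holds for
   u -> y because Tini > l makes the past determine the observable state. *)

(** * Trajectories generated by an initial state and inputs *)

Section Trajectories.
Context {R : realType} {nx k r : nat}.
Variables (A : 'M[R]_nx) (B : 'M[R]_(nx, k)) (C : 'M[R]_(r, nx))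
  (D : 'M[R]_(r, k)).

(* The c columns of X and U are c initial states and c inputs, so that several
   trajectories are handled at once. *)
Fixpoint state c (X : 'M[R]_(nx, c)) (U : nat -> 'M[R]_(k, c)) t : 'M_(nx, c) :=
  if t is t'.+1 then A *m state X U t' + B *m U t' else X.

Definition trajectory c (X : 'M[R]_(nx, c)) (U : nat -> 'M[R]_(k, c)) t :
    'M_(k + r, c) :=
  col_mx (U t) (C *m state X U t + D *m U t).

Lemma state_mul c e (X : 'M_(nx, c)) U (V : 'M_(c, e)) t :
  state (X *m V) (fun s => U s *m V) t = state X U t *m V.
Proof. by elim: t => //= t ->; rewrite mulmxDl !mulmxA. Qed.

Lemma trajectory_mul c e (X : 'M_(nx, c)) U (V : 'M_(c, e)) t :
  trajectory (X *m V) (fun s => U s *m V) t = trajectory X U t *m V.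
Proof. by rewrite /trajectory state_mul mul_col_mx mulmxDl !mulmxA. Qed.

Lemma stateB c (X X' : 'M_(nx, c)) U U' t :
  state (X - X') (fun s => U s - U' s) t = state X U t - state X' U' t.
Proof. by elim: t => //= t ->; rewrite !mulmxBr addrACA -opprD. Qed.

Lemma eq_state c (X : 'M_(nx, c)) U U' t :
  (forall s, (s < t)%N -> U s = U' s) -> state X U t = state X U' t.
Proof.
elim: t => //= t IH eqU; rewrite (eqU t) // IH // => s lts.
by apply: eqU; rewrite ltnW.
Qed.

Lemma eq_trajectory c (X : 'M_(nx, c)) U U' t :
  (forall s, (s <= t)%N -> U s = U' s) -> trajectory X U t = trajectory X U' t.
Proof.
move=> eqU; rewrite /trajectory (eqU t) // (@eq_state _ _ _ U') // => s lts.
by apply: eqU; rewrite ltnW.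
Qed.

Lemma state_zero_input c (X : 'M_(nx, c)) t : state X (fun _ => 0) t = A ^+ t *m X.
Proof.
elim: t => [|t IH] /=; first by rewrite expr0 mul1mx.
by rewrite IH mulmx0 addr0 exprS -mulmxE mulmxA.
Qed.

Lemma behavior_trajectory x u : behavior A B C D (trajectory x u).
Proof.
by exists (state x u) => t; rewrite /trajectory col_mxKu col_mxKd.
Qed.

(** Time invariance: the window starting at time [s] is driven by the state reached at that time.
    One function [X] serves all [s], so that all columns of a Hankel matrix can be described at
    once. *)
Lemma behavior_shift w : behavior A B C D w ->
  exists X, forall s t, w (s + t)%N = trajectory (X s) (fun i => usubmx (w (s + i)%N)) t.
Proof.
move=> [x xP]; exists x => s t.
suff /(_ t) E : forall i, state (x s) (fun i => usubmx (w (s + i)%N)) i = x (s + i)%N.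
  by rewrite /trajectory E -(xP _).2 vsubmxK.
elim=> [|i IH] /=; first by rewrite addn0.
by rewrite IH addnS (xP _).1.
Qed.

(** By causality and linearity, a window is a linear image of the initial state and the first [L]
    inputs. The number of columns of [M] will bound the dimension of the space of windows. *)
Lemma window_matrix s (E : 'M[R]_(s, k + r)) L :
  exists M : 'M_(\sum_(i < L) s, nx + \sum_(i < L) k), forall c (X : 'M_(nx, c)) U,
    \mxcol_(i < L) (E *m trajectory X U i) = M *m col_mx X (\mxcol_(i < L) U i).
Proof.
(* [S t] picks block [t] of the stacked inputs; its default 0 concerns only [t >= L], beyond the
   window. *)
pose S t : 'M[R]_(k, \sum_(i < L) k) :=
  if insub t is Some i then submxcol 1%:M (i : 'I_L) else 0.
(* [M] is the window of a universal trajectory, with initial state [[1 0]] and inputs [[0 S t]];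
   every other window is a right multiple of it. *)
exists (\mxcol_(i < L) (E *m trajectory (row_mx 1%:M 0) (fun t => row_mx 0 (S t)) i)).
move=> c X U; rewrite mxcol_mul; apply/eq_mxcolP => i.
rewrite -mulmxA -trajectory_mul mul_row_col mul1mx mul0mx addr0; congr (E *m _).
apply: eq_trajectory => t le_ti.
rewrite mul_row_col mul0mx add0r /S.
have lt_tL : (t < L)%N := leq_ltn_trans le_ti (ltn_ord i).
by rewrite insubT submxcol_mul mul1mx mxcolK.
Qed.

End Trajectories.

(** * Hankel columns as windows of trajectories *)

Lemma hankel_index_lt (T L i : nat) (ltiL : (i < L)%N) (j : 'I_(T.+1 - L)) :
  (i + j < T)%N.
Proof.
have := ltn_ord j; rewrite ltn_subRL ltnS; apply: leq_trans.
by rewrite ltn_add2r.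
Qed.

Section Hankel_span.
Context {R : realType} {nx k r : nat}.
Variables (A : 'M[R]_nx) (B : 'M[R]_(nx, k)) (C : 'M[R]_(r, nx))
  (D : 'M[R]_(r, k)).
Variables (s T L : nat) (E : 'M[R]_(s, k + r)) (d : T.-tuple 'cV[R]_s)
  (z : nat -> 'cV[R]_(k + r)).
Hypothesis dE : forall t, (t < T)%N -> d`_t = E *m z t.+1.

Lemma hankel_row_trajectory : behavior A B C D z ->
  exists X U, forall i, (i < L)%N ->
    hankel_row d L i = E *m trajectory A B C D X U i.
Proof.
move=> /behavior_shift[X zE].
pose X' : 'M_(nx, T.+1 - L) := \matrix_(a, j) X j.+1 a 0.
pose U i : 'M_(k, T.+1 - L) := \matrix_(a, j) usubmx (z (j.+1 + i)%N) a 0.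
exists X', U => i ltiL; apply/matrixP => a j; rewrite mxE.
(* The index stays inside the tuple, so the default of [nth] is never read. The sample of index
   [i + j] is [z] at time [i + j + 1], as the data start at time 1. *)
have lt_ijT := hankel_index_lt ltiL j.
rewrite dE // [(i + j)%N]addnC -addSn (zE j.+1).
have -> : X j.+1 = X' *m delta_mx j 0 by rewrite -colE; apply/colP => b; rewrite !mxE.
rewrite (@eq_trajectory _ _ _ _ _ _ _ _ _ _ _ (fun t => U t *m delta_mx j (0 : 'I_1))) => [|t _].
  by rewrite trajectory_mul mulmxA -colE mxE.
by rewrite -colE; apply/colP => b; rewrite !mxE.
Qed.

(** The inclusion that follows from linearity: combining columns combines their initial states and
    inputs. *)
Lemma window_of_hankel : behavior A B C D z ->
  forall g : 'cV[R]_(T.+1 - L), exists x u, forall i, (i < L)%N ->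
    hankel_row d L i *m g = E *m trajectory A B C D x u i.
Proof.
move=> /hankel_row_trajectory[X [U HE]] g.
exists (X *m g), (fun i => U i *m g) => i ltiL.
by rewrite HE // trajectory_mul mulmxA.
Qed.

End Hankel_span.

(* The windows of length L form a space of dimension at most k * L + n, as they
   are parametrized by the state and the inputs of a representation of order n;
   hence Hankel columns of that rank span all of them. *)
Lemma hankel_of_window {R : realType} {nx k r s n T L : nat} (A : 'M[R]_nx)
    (B : 'M[R]_(nx, k)) (C : 'M[R]_(r, nx)) (D : 'M[R]_(r, k))
    (E : 'M[R]_(s, k + r)) (d : T.-tuple 'cV[R]_s) z :
  behavior A B C D z -> (forall t, (t < T)%N -> d`_t = E *m z t.+1) ->
  representable (behavior A B C D) n -> \rank (hankel d L) = (k * L + n)%N ->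
  forall x u, exists g : 'cV[R]_(T.+1 - L), forall i, (i < L)%N ->
    hankel_row d L i *m g = E *m trajectory A B C D x u i.
Proof.
move=> zP dE [A' [B' [C' [D' eqbeh]]]] rkH x u.
have [M MP] := window_matrix A' B' C' D' E L.
have [X [U HE]] := hankel_row_trajectory L dE ((eqbeh z).1 zP).
have HM : hankel d L = M *m col_mx X (\mxcol_(i < L) U i).
  by rewrite -MP; apply/eq_mxcolP => i; rewrite HE.
have rkM : (\rank M <= k * L + n)%N.
  by apply: leq_trans (rank_leq_col M) _; rewrite sum_nat_const card_ord addnC mulnC.
(* The order on matrices compares row spaces, so column spaces are compared through transposes. *)
have sHM : ((hankel d L)^T <= M^T)%MS by rewrite HM trmx_mul submxMl.
have sMH : (M^T <= (hankel d L)^T)%MS.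
  rewrite -(geq_leqif (mxrank_leqif_sup sHM)) !mxrank_tr rkH.
  exact: rkM.
have /submxP[G /(congr1 trmx)] := sMH; rewrite trmxK trmx_mul trmxK => ME.
(* The given window is also a trajectory of the [n]-dimensional representation, with the same inputs
   but an initial state of its own; [M] applies to that state. *)
have [X' xE] := behavior_shift ((eqbeh _).1 (behavior_trajectory A B C D x u)).
exists (G^T *m col_mx (X' 0%N) (\mxcol_(i < L) usubmx (trajectory A B C D x u i))).
move=> i ltiL.
have : hankel d L *m (G^T *m col_mx (X' 0%N)
  (\mxcol_(i < L) usubmx (trajectory A B C D x u i))) =
  \mxcol_(i < L) (E *m trajectory A B C D x u i).
  rewrite mulmxA -ME -(MP _ _ (fun i => usubmx (trajectory A B C D x u i))); apply/eq_mxcolP => j.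
  by rewrite -[nat_of_ord j in RHS]add0n xE.
by rewrite /hankel mxcol_mul => /eq_mxcolP/(_ (Ordinal ltiL)).
Qed.

(** * Observability matrix and order *)

Section Observability.
Context {R : realType} {nx k r n : nat}.
Variables (A : 'M[R]_nx) (B : 'M[R]_(nx, k)) (C : 'M[R]_(r, nx))
  (D : 'M[R]_(r, k)).

(** The free responses of the unit states are also trajectories of the [n]-dimensional
    representation, so the observability matrix factors through its state space. *)
Lemma rank_observability L : representable (behavior A B C D) n ->
  (\rank (observability A C L) <= n)%N.
Proof.
move=> [A' [B' [C' [D' eqbeh]]]].
have [X XP] : exists X : 'I_nx -> 'cV[R]_n, forall j i,
    C *m (A ^+ i *m delta_mx j (0 : 'I_1)) = C' *m (A' ^+ i *m X j).
  apply: (@fin_all_exists 'I_nx (fun=> 'cV[R]_n) (fun j x => forall i,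
    C *m (A ^+ i *m delta_mx j (0 : 'I_1)) = C' *m (A' ^+ i *m x))) => j.
  have /eqbeh/behavior_shift[X' xE] :=
    behavior_trajectory A B C D (delta_mx j (0 : 'I_1)) (fun _ => 0).
  exists (X' 0%N) => i.
  have := xE 0%N i; rewrite add0n => /(congr1 dsubmx).
  rewrite /trajectory !col_mxKd col_mxKu !mulmx0 !addr0 state_zero_input => ->.
  by rewrite -(state_zero_input A' B'); congr (C' *m _); apply: eq_state => t; rewrite ?col_mxKu.
have -> : observability A C L = observability A' C' L *m \matrix_(a, j) X j a 0.
  rewrite /observability mxcol_mul; apply/eq_mxcolP => i.
  apply/matrixP => a j; have := XP j i => /colP/(_ a).
  rewrite mulmxA -colE mxE => ->; rewrite !mulmxA.
  by rewrite !mxE; apply: eq_bigr => b _; rewrite !mxE.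
exact: leq_trans (mxrankM_maxl _ _) (rank_leq_col _).
Qed.

(** The rank reaches its largest possible value [n] with [l] blocks, so all later block rows depend
    on the first [l] and vanish on [x] with them. *)
Lemma observable_extension l T L (x : 'cV[R]_nx) :
  representable (behavior A B C D) n ->
  \rank (observability A C l) = n -> (l <= T)%N ->
  (forall i, (i < T)%N -> C *m (A ^+ i *m x) = 0) ->
  forall i, (i < L)%N -> C *m (A ^+ i *m x) = 0.
Proof.
move=> repn rkO lelT x0 i ltiL.
(* [N] dominates both [l] and [L], whose order is unknown. *)
pose N := maxn l L.
have sub : (observability A C l <= observability A C N)%MS.
  apply/submxP; exists (\mxcol_(j < l) submxcol 1%:M (widen_ord (leq_maxl l L) j)).
  rewrite mxcol_mul; apply/eq_mxcolP => j.
  by rewrite submxcol_mul mul1mx mxcolK.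
have : (observability A C N <= observability A C l)%MS.
  by rewrite -(geq_leqif (mxrank_leqif_sup sub)) rkO rank_observability.
move=> /submxP[G /(congr1 (mulmx^~ x))]; rewrite -mulmxA.
have -> : observability A C l *m x = 0.
  rewrite /observability mxcol_mul -(mxcol0 (p_ := fun=> r)); apply/eq_mxcolP => j.
  by rewrite -mulmxA x0 // (leq_trans (ltn_ord j)).
have ltiN : (i < N)%N by rewrite leq_max ltiL orbT.
rewrite mulmx0 /observability mxcol_mul -(mxcol0 (p_ := fun=> r)).
by move=> /eq_mxcolP/(_ (Ordinal ltiN)) /=; rewrite -mulmxA.
Qed.

End Observability.

(** * The four conditions in terms of trajectories *)

Section Becaus_conditions.
Context {R : realType} {nx k r : nat}.
Variables (A : 'M[R]_nx) (B : 'M[R]_(nx, k)) (C : 'M[R]_(r, nx))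
  (D : 'M[R]_(r, k)).
Local Notation traj := (trajectory A B C D).

Definition with_input (u : nat -> 'cV[R]_k) s v t := if t == s then v else u t.

Lemma trajectory_with_input_lt x u s v t : (t < s)%N ->
  traj x (with_input u s v) t = traj x u t.
Proof.
move=> lts; apply: eq_trajectory => i leit.
by rewrite /with_input ltn_eqF // (leq_ltn_trans leit).
Qed.

Lemma trajectory_with_input x u s v :
  traj x (with_input u s v) s = col_mx v (C *m state A B x u s + D *m v).
Proof.
rewrite /trajectory {1 3}/with_input eqxx.
rewrite (@eq_state _ _ _ _ _ _ _ _ u) // => t lts.
by rewrite /with_input ltn_eqF.
Qed.

Section Conditions.
Context {m p T : nat}.
Implicit Types (th : T.-tuple 'cV[R]_m) (ps : T.-tuple 'cV[R]_p)
  (f : 'cV[R]_(k + r) -> 'cV[R]_m) (h : 'cV[R]_(k + r) -> 'cV[R]_p).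

Definition consistent th ps f h Tini x u : Prop := forall i, (i < Tini)%N ->
  th`_i = f (traj x u i) /\ ps`_i = h (traj x u i).

(** All that the conditions will use of identifiability. The signals [f] and [h] are left abstract
    so that theta and psi can be exchanged. *)
Definition hankel_spans th ps f h Tini : Prop :=
  [/\ forall x u, exists g : 'cV[R]_(T.+1 - (Tini + 2)), forall i, (i < Tini + 2)%N ->
        hankel_row th (Tini + 2) i *m g = f (traj x u i) /\
        hankel_row ps (Tini + 2) i *m g = h (traj x u i),
      forall g : 'cV[R]_(T.+1 - (Tini + 2)), exists x u, forall i, (i < Tini + 2)%N ->
        hankel_row th (Tini + 2) i *m g = f (traj x u i) /\
        hankel_row ps (Tini + 2) i *m g = h (traj x u i)
    & exists x u, consistent th ps f h Tini x u].

Definition attains_none q (f : 'cV[R]_(k + r) -> 'cV[R]_q) : Prop :=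
  exists b, forall x v, f (col_mx v (C *m x + D *m v)) <> b.

(** [y] stands for the contribution [C x] of the state, which the past fixes. *)
Definition free_signal q (f : 'cV[R]_(k + r) -> 'cV[R]_q) : Prop :=
  forall y b, exists v, f (col_mx v (y + D *m v)) = b.

(** Adding [v] to the last input leaves the state unchanged, so it moves the last sample by exactly
    [col_mx v (D *m v)]; this move is seen by [h] but not by [f]. *)
Definition input_separates f h : Prop := exists v, forall w : 'cV[R]_(k + r),
  f (w + col_mx v (D *m v)) = f w /\ h (w + col_mx v (D *m v)) <> h w.

Variables (th : T.-tuple 'cV[R]_m) (ps : T.-tuple 'cV[R]_p) (Tini : nat)
  (f : 'cV[R]_(k + r) -> 'cV[R]_m) (h : 'cV[R]_(k + r) -> 'cV[R]_p).
Hypothesis span : hankel_spans th ps f h Tini.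
Local Notation L := (Tini + 2)%N.

Let lt0L : (Tini < L)%N. Proof. by rewrite addn2 ltnW. Qed.
Let lt1L : (Tini.+1 < L)%N. Proof. by rewrite addn2. Qed.

Lemma consistent_with_input x u s v : (Tini <= s)%N ->
  consistent th ps f h Tini x u -> consistent th ps f h Tini x (with_input u s v).
Proof.
move=> le_s cons i lti.
by rewrite trajectory_with_input_lt ?(leq_trans lti) //; exact: cons.
Qed.

Lemma initial_windowP (g : 'cV[R]_(T.+1 - L)) x u :
  (forall i, (i < L)%N -> hankel_row th L i *m g = f (traj x u i) /\
      hankel_row ps L i *m g = h (traj x u i)) ->
  consistent th ps f h Tini x u <->
  col_mx (hankel_past th Tini) (hankel_past ps Tini) *m g =
  col_mx (initial th Tini) (initial ps Tini).
Proof.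
move=> gE; rewrite mul_col_mx /hankel_past /initial !mxcol_mul; split=> [cons|].
  have gE' i (lti : (i < Tini)%N) := gE i (ltn_trans lti lt0L).
  congr col_mx; apply/eq_mxcolP => i.
    by rewrite (gE' i (ltn_ord i)).1 (cons i (ltn_ord i)).1.
  by rewrite (gE' i (ltn_ord i)).2 (cons i (ltn_ord i)).2.
move=> /eq_col_mx[/eq_mxcolP Eth /eq_mxcolP Eps] i lti.
have := Eth (Ordinal lti); have := Eps (Ordinal lti) => /= <- <-.
exact: gE (ltn_trans lti lt0L).
Qed.

(** Eliminates [g]: each direction uses one of the two inclusions of [hankel_spans]. *)
Lemma eqEP thf psf : (exists g : 'cV[R]_(T.+1 - L), Defs.eqE th ps g thf psf) <->
  exists x u, [/\ consistent th ps f h Tini x u,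
    thf = col_mx (f (traj x u Tini)) (f (traj x u Tini.+1))
  & psf = col_mx (h (traj x u Tini)) (h (traj x u Tini.+1))].
Proof.
have [spanl spanr _] := span.
have futE g x u : (forall i, (i < L)%N ->
      hankel_row th L i *m g = f (traj x u i) /\
      hankel_row ps L i *m g = h (traj x u i)) ->
    col_mx (hankel_future th Tini) (hankel_future ps Tini) *m g =
    col_mx (col_mx (f (traj x u Tini)) (f (traj x u Tini.+1)))
           (col_mx (h (traj x u Tini)) (h (traj x u Tini.+1))).
  move=> gE; rewrite !mul_col_mx.
  by have [-> ->] := gE _ lt0L; have [-> ->] := gE _ lt1L.
rewrite /Defs.eqE; split=> [[g]|[x [u [cons -> ->]]]].
  have [x [u gE]] := spanr g.
  rewrite mul_col_mx (futE _ _ _ gE) => /eq_col_mx[/(initial_windowP gE).2 cons].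
  by move=> /eq_col_mx[<- <-]; exists x, u.
have [g gE] := spanl x u; exists g.
by rewrite mul_col_mx (futE _ _ _ gE) (initial_windowP gE).1.
Qed.

Lemma eqE'P thf1 psf1 : (exists g : 'cV[R]_(T.+1 - L), Defs.eqE' th ps g thf1 psf1) <->
  exists x u, [/\ consistent th ps f h Tini x u,
    thf1 = f (traj x u Tini) & psf1 = h (traj x u Tini)].
Proof.
have [spanl spanr _] := span.
rewrite /Defs.eqE' /hankel_future !col_mxKu; split=> [[g]|[x [u [cons -> ->]]]].
  have [x [u gE]] := spanr g; have [thE psE] := gE _ lt0L.
  rewrite mul_col_mx => /eq_col_mx[/(initial_windowP gE).2 cons].
  by rewrite mul_col_mx thE psE => /eq_col_mx[<- <-]; exists x, u.
have [g gE] := spanl x u; exists g; have [thE psE] := gE _ lt0L.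
by rewrite mul_col_mx (initial_windowP gE).1 // mul_col_mx thE psE.
Qed.

(** Here existence fails. *)
Lemma cond1_attains_none : attains_none f -> ~ cond1 th ps Tini.
Proof.
move=> [b fb] c1; have [psf [/eqEP[x [u [_ bE _]]] _]] := c1 (col_mx b b).
by have [/esym bE' _] := eq_col_mx bE; exact: fb bE'.
Qed.

(** Here uniqueness fails: changing the last input by [v] keeps the past and the values of [f], but
    not the last value of [h]. *)
Lemma cond1_input_separates : input_separates f h -> ~ cond1 th ps Tini.
Proof.
move=> [v vP] c1; have [_ _ [x [u cons]]] := span.
have [psf [_ psfU]] := c1 (col_mx (f (traj x u Tini)) (f (traj x u Tini.+1))).
pose u' := with_input u Tini.+1 (u Tini.+1 + v).
have trE : traj x u' Tini.+1 = traj x u Tini.+1 + col_mx v (D *m v).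
  by rewrite trajectory_with_input /trajectory add_col_mx [D *m _]mulmxDr addrA.
have psf0 := psfU (col_mx (h (traj x u Tini)) (h (traj x u Tini.+1))).
have psf1 := psfU (col_mx (h (traj x u' Tini)) (h (traj x u' Tini.+1))).
have [fv hv] := vP (traj x u Tini.+1); apply: hv; rewrite -trE.
have /eq_col_mx[_ //] :
  col_mx (h (traj x u' Tini)) (h (traj x u' Tini.+1)) =
  col_mx (h (traj x u Tini)) (h (traj x u Tini.+1)).
rewrite -psf0; last by apply/eqEP; exists x, u.
apply/esym/psf1/eqEP; exists x, u'; split; rewrite ?trE ?fv //.
- exact: consistent_with_input.
- by rewrite trajectory_with_input_lt.
Qed.

(** The missed value is prescribed as the second future sample, which (E') does not constrain. *)
Lemma cond3_attains_none : attains_none h -> cond3 th ps Tini.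
Proof.
move=> [b hb]; have [_ _ [x [u cons]]] := span.
exists (f (traj x u Tini)), (h (traj x u Tini)), b; split.
  by apply/eqE'P; exists x, u.
move=> [g [thf2 gE]]; have [x' [u' [_ _]]] := (eqEP _ _).1 (ex_intro _ g gE).
by move=> /eq_col_mx[_ /esym]; exact: hb.
Qed.

(** A trajectory solving (E') is kept up to its last input, which is chosen anew to give [h] the
    prescribed value; the unknown second sample of theta absorbs the effect on [f]. *)
Lemma cond3_free_signal : free_signal h -> ~ cond3 th ps Tini.
Proof.
move=> free [thf1 [psf1 [psf2 [/eqE'P[x [u [cons -> ->]]] nE]]]]; apply: nE.
have [v vE] := free (C *m state A B x u Tini.+1) psf2.
pose u' := with_input u Tini.+1 v.
have [|g gE] := (eqEP (col_mx (f (traj x u Tini)) (f (traj x u' Tini.+1)))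
    (col_mx (h (traj x u Tini)) psf2)).2; last by exists g, (f (traj x u' Tini.+1)).
exists x, u'; split.
- exact: consistent_with_input.
- by rewrite [traj x u' Tini]trajectory_with_input_lt.
- by rewrite trajectory_with_input_lt // trajectory_with_input vE.
Qed.

End Conditions.

Lemma hankel_spansC m p T (th : T.-tuple 'cV[R]_m) (ps : T.-tuple 'cV[R]_p) Tini f h :
  hankel_spans th ps f h Tini -> hankel_spans ps th h f Tini.
Proof.
move=> [spanl spanr [x0 [u0 cons]]]; split.
- by move=> x u; have [g gP] := spanl x u; exists g => i /gP[].
- by move=> g; have [x [u gP]] := spanr g; exists x, u => i /gP[].
- by exists x0, u0 => i /cons[].
Qed.

(* The outputs at the first Tini times determine the state up to an
   unobservable component, and hence, given the inputs, all later outputs. *)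
Lemma cond1_input_output T (th : T.-tuple 'cV[R]_k) (ps : T.-tuple 'cV[R]_r) Tini :
  (forall x : 'cV[R]_nx, (forall i, (i < Tini)%N -> C *m (A ^+ i *m x) = 0) ->
    forall i, (i < Tini + 2)%N -> C *m (A ^+ i *m x) = 0) ->
  hankel_spans th ps usubmx dsubmx Tini -> cond1 th ps Tini.
Proof.
move=> obs span thf; have [_ _ [x [u cons]]] := span.
pose u' := with_input (with_input u Tini (usubmx thf)) Tini.+1 (dsubmx thf).
exists (col_mx (dsubmx (traj x u' Tini)) (dsubmx (traj x u' Tini.+1))).
split.
  apply/(eqEP span); exists x, u'; split => //.
    by apply: consistent_with_input => //; exact: consistent_with_input.
  rewrite [traj x u' Tini]trajectory_with_input_lt //.
  by rewrite !trajectory_with_input !col_mxKu vsubmxK.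
move=> psf /(eqEP span)[y [v [consy thfE ->]]].
(* [th] records the inputs themselves, so both trajectories have the recorded inputs before [Tini]
   and those listed in [thf] afterwards. *)
have uE i : (i < Tini + 2)%N -> u' i = v i.
  rewrite addn2 !ltnS leq_eqVlt => /orP[/eqP->|].
    have [_ <-] : thf = col_mx (v Tini) (v Tini.+1) /\ dsubmx thf = v Tini.+1.
      by rewrite thfE /trajectory !col_mxKu col_mxKd.
    by rewrite /u' /with_input eqxx.
  rewrite ltnS leq_eqVlt => /orP[/eqP->|lti].
    have <- : usubmx thf = v Tini.
      by rewrite thfE /trajectory !col_mxKu.
    by rewrite /u' /with_input ltn_eqF // eqxx.
  have [thi _] := cons _ lti; have [thi' _] := consy _ lti.
  move: thi'; rewrite thi /trajectory !col_mxKu.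
  by rewrite /u' /with_input !ltn_eqF // ltnW.
(* Since the inputs agree, the outputs differ by the free response of [x - y]. *)
have stE i : (i < Tini + 2)%N ->
    C *m (A ^+ i *m (x - y)) = dsubmx (traj x u' i) - dsubmx (traj y v i).
  move=> lti; rewrite -(state_zero_input A B) /trajectory !col_mxKd (uE _ lti).
  rewrite opprD addrACA subrr addr0 -mulmxBr -stateB; congr (C *m _).
  by apply: eq_state => s lts; rewrite uE ?subrr // (ltn_trans lts).
(* Before [Tini] both outputs equal the recorded ones, so the free response vanishes there, and
   [obs] carries this to the two future samples. *)
have psE i : (i < Tini + 2)%N -> dsubmx (traj x u' i) = dsubmx (traj y v i).
  move=> lti; apply/eqP; rewrite -subr_eq0 -stE //; apply/eqP; apply: obs => // j ltj.
  rewrite stE ?(ltn_trans ltj) ?addn2 //.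
  have [_ <-] := consy _ ltj; have [_ ->] := cons _ ltj.
  by rewrite !trajectory_with_input_lt ?subrr // ltnW.
by rewrite !psE // addn2 // ltnW.
Qed.

End Becaus_conditions.

(** * Exchanging theta and psi *)

Lemma eqEC {R : realType} {m p T : nat} (th : T.-tuple 'cV[R]_m)
    (ps : T.-tuple 'cV[R]_p) Tini
    (g : 'cV[R]_(T.+1 - (Tini + 2))) thf psf :
  Defs.eqE th ps g thf psf <-> Defs.eqE ps th g psf thf.
Proof.
by rewrite /Defs.eqE !mul_col_mx; split=> /eq_col_mx[/eq_col_mx[-> ->] /eq_col_mx[-> ->]].
Qed.

Lemma eqE'C {R : realType} {m p T : nat} (th : T.-tuple 'cV[R]_m)
    (ps : T.-tuple 'cV[R]_p) Tini
    (g : 'cV[R]_(T.+1 - (Tini + 2))) thf1 psf1 :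
  Defs.eqE' th ps g thf1 psf1 <-> Defs.eqE' ps th g psf1 thf1.
Proof.
by rewrite /Defs.eqE' !mul_col_mx; split=> /eq_col_mx[/eq_col_mx[-> ->] /eq_col_mx[-> ->]].
Qed.

Lemma cond2C {R : realType} {m p T : nat} (th : T.-tuple 'cV[R]_m)
    (ps : T.-tuple 'cV[R]_p) Tini : cond2 th ps Tini <-> cond1 ps th Tini.
Proof.
split=> c b; have [a [[g gE] aU]] := c b; exists a; split.
- by exists g; apply/eqEC.
- by move=> a' [g' g'E]; apply: aU; exists g'; apply/eqEC.
- by exists g; apply/eqEC.
- by move=> a' [g' g'E]; apply: aU; exists g'; apply/eqEC.
Qed.

Lemma cond4C {R : realType} {m p T : nat} (th : T.-tuple 'cV[R]_m)
    (ps : T.-tuple 'cV[R]_p) Tini : cond4 th ps Tini <-> cond3 ps th Tini.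
Proof.
split=> [[a [b [c [[g gE] nE]]]]|[a [b [c [[g gE] nE]]]]]; exists b, a, c;
  (split; first by exists g; apply/eqE'C);
  by move=> [g' [c' g'E]]; apply: nE; exists g', c'; apply/eqEC.
Qed.

(** * Signals as matrix images, and joined time series *)

Lemma usubmx_mul {R : realType} (m p : nat) (w : 'cV[R]_(m + p)) :
  usubmx w = row_mx 1%:M 0 *m w.
Proof. by rewrite -{2}[w]vsubmxK mul_row_col mul1mx mul0mx addr0. Qed.

Lemma dsubmx_mul {R : realType} (m p : nat) (w : 'cV[R]_(m + p)) :
  dsubmx w = row_mx 0 1%:M *m w.
Proof. by rewrite -{2}[w]vsubmxK mul_row_col mul1mx mul0mx add0r. Qed.

Lemma theta_of_mx {R : realType} {k1 k2 r1 r2 : nat} rel : exists E,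
  forall w : 'cV[R]_((k1 + k2) + (r1 + r2)), theta_of rel w = E *m w.
Proof.
case: rel; rewrite /= /sig_u1 /sig_y1 /sig_u /sig_y;
  (eexists => w; rewrite ?dsubmx_mul ?usubmx_mul ?mulmxA; reflexivity).
Qed.

Lemma psi_of_mx {R : realType} {k1 k2 r1 r2 : nat} rel : exists E,
  forall w : 'cV[R]_((k1 + k2) + (r1 + r2)), psi_of rel w = E *m w.
Proof.
case: rel; rewrite /= /sig_u1 /sig_u2 /sig_y2 /sig_u /sig_y;
  (eexists => w; rewrite ?dsubmx_mul ?usubmx_mul ?mulmxA; reflexivity).
Qed.

Lemma hidden_of_mx {R : realType} {k1 k2 r1 r2 : nat} rel : exists E,
  forall w : 'cV[R]_((k1 + k2) + (r1 + r2)), hidden_of rel w = E *m w.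
Proof.
case: rel; rewrite /= /sig_u2 /sig_u /sig_y;
  try (eexists => w; rewrite ?dsubmx_mul ?usubmx_mul ?mulmxA; reflexivity);
  by exists 0 => w; rewrite mul0mx.
Qed.

Lemma nth_join {R : realType} {r s T : nat} (w : T.-tuple 'cV[R]_r)
    (z : T.-tuple 'cV[R]_s) t : (t < T)%N -> (join w z)`_t = col_mx w`_t z`_t.
Proof.
by move=> ltT; rewrite /join /= (nth_map (Ordinal ltT)) ?size_enum_ord // nth_enum_ord.
Qed.

Lemma hankel_row_join {R : realType} {r s T : nat} (w : T.-tuple 'cV[R]_r)
    (z : T.-tuple 'cV[R]_s) L i : (i < L)%N ->
  hankel_row (join w z) L i = col_mx (hankel_row w L i) (hankel_row z L i).
Proof.
move=> ltiL; apply/matrixP => a j; rewrite mxE.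
have lt_ijT := hankel_index_lt ltiL j.
by rewrite nth_join // !mxE; case: splitP => b _; rewrite mxE.
Qed.

Lemma full_rank_data_join {R : realType} {k1 k2 r1 r2 T n L : nat} rel
    (th : T.-tuple 'cV[R]_(theta_dim rel k1 k2 r1 r2))
    (ps : T.-tuple 'cV[R]_(psi_dim rel k1 k2 r1 r2))
    (v : T.-tuple 'cV[R]_(hidden_dim rel k1 k2 r1 r2)) :
  full_rank_data th ps v n L ->
  \rank (hankel (join th ps) L) = ((k1 + k2) * L + n)%N \/
  \rank (hankel (join (join th ps) v) L) = ((k1 + k2) * L + n)%N.
Proof. by case: rel th ps v => th ps v /=; by [left | right]. Qed.

(** * From identifiability to the spanning property *)

Section Identifiable.
Context {R : realType} {nx k1 k2 r1 r2 : nat}.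
Variables (A : 'M[R]_nx) (B : 'M[R]_(nx, k1 + k2)) (C : 'M[R]_(r1 + r2, nx))
  (D : 'M[R]_(r1 + r2, k1 + k2)).

Lemma identifiable_hankel_spans rel n l T Tini
    (th : T.-tuple 'cV[R]_(theta_dim rel k1 k2 r1 r2))
    (ps : T.-tuple 'cV[R]_(psi_dim rel k1 k2 r1 r2)) :
  (0 < k1 + k2)%N -> representable (behavior A B C D) n ->
  identifiable_at rel (behavior A B C D) n l th ps Tini ->
  hankel_spans A B C D th ps (theta_of rel) (psi_of rel) Tini.
Proof.
move=> k_gt0 repn [_ [v [[z [zP wE]] full]]].
have [Eth EthE] := theta_of_mx (R := R) (k1 := k1) (k2 := k2) (r1 := r1) (r2 := r2) rel.
have [Eps EpsE] := psi_of_mx (R := R) (k1 := k1) (k2 := k2) (r1 := r1) (r2 := r2) rel.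
have [Ev EvE] := hidden_of_mx (R := R) (k1 := k1) (k2 := k2) (r1 := r1) (r2 := r2) rel.
pose d2 := join th ps; pose d3 := join d2 v.
have d2E t : (t < T)%N -> d2`_t = col_mx Eth Eps *m z t.+1.
  by move=> ltT; have [th_t ps_t _] := wE _ ltT; rewrite nth_join // mul_col_mx th_t ps_t EthE EpsE.
have d3E t : (t < T)%N -> d3`_t = col_mx (col_mx Eth Eps) Ev *m z t.+1.
  by move=> ltT; have [_ _ v_t] := wE _ ltT; rewrite nth_join // mul_col_mx d2E // v_t EvE.
set L := (Tini + 2)%N.
have span2 x u : exists g : 'cV[R]_(T.+1 - L), forall i, (i < L)%N ->
    hankel_row d2 L i *m g = col_mx Eth Eps *m trajectory A B C D x u i.
  have [rk|rk] := full_rank_data_join full; first exact: hankel_of_window zP d2E repn rk x u.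
  (* If the rank condition includes the hidden signal, the larger Hankel matrix spans its windows,
     and the hidden rows are then dropped. *)
  have [g gE] := hankel_of_window zP d3E repn rk x u; exists g => i ltiL.
  by have := gE _ ltiL; rewrite hankel_row_join // !mul_col_mx => /eq_col_mx[].
split.
- move=> x u; have [g gE] := span2 x u; exists g => i ltiL.
  have := gE _ ltiL; rewrite hankel_row_join // !mul_col_mx => /eq_col_mx[-> ->].
  by rewrite EthE EpsE.
- move=> g; have [x [u gE]] := window_of_hankel d2E zP g; exists x, u => i ltiL.
  have := gE _ ltiL; rewrite hankel_row_join // !mul_col_mx => /eq_col_mx[-> ->].
  by rewrite EthE EpsE.
(* A positive rank forces the Hankel matrix to have a column, so the first [Tini] samples are
   recorded ones and not defaults of [nth]. *)
have leT : (L <= T)%N.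
  have gt0 : (0 < (k1 + k2) * L + n)%N by rewrite addn_gt0 muln_gt0 k_gt0 /L addn2.
  rewrite -ltnS -subn_gt0; apply: leq_trans gt0 _.
  by have [<-|<-] := full_rank_data_join full; exact: rank_leq_col.
have [X XE] := behavior_shift zP.
exists (X 1%N), (fun i => usubmx (z (1 + i)%N)) => i ltiT.
have [-> -> _] : [/\ th`_i = theta_of rel (z i.+1), ps`_i = psi_of rel (z i.+1)
      & v`_i = hidden_of rel (z i.+1)].
  by apply: wE; apply: leq_trans leT; rewrite /L addn2 !ltnS ltnW // ltnW.
by rewrite -XE.
Qed.

End Identifiable.

(** * Consequences of the assumptions on the blocks of C and D *)

Lemma not_row_free_not_onto {R : realType} {a b c d : nat} (M1 : 'M[R]_(a, b))
    (M2 : 'M[R]_(a, c)) (M3 : 'M[R]_(a, d)) :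
  ~~ row_free (row_mx M1 (row_mx M2 M3)) ->
  exists y : 'cV[R]_a, forall x v1 v2, M1 *m x + (M2 *m v1 + M3 *m v2) <> y.
Proof.
rewrite -kermx_eq0 => /eqP ker0.
have /rowV0Pn[w /sub_kermxP wM w0] : kermx (row_mx M1 (row_mx M2 M3)) != 0 by apply/eqP.
(* The left kernel vector [w] annihilates the image; if [w^T] were in it, then [w *m w^T], a sum of
   squares, would vanish. *)
exists w^T => x v1 v2 wE; move/eqP: w0; apply.
have : w *m w^T = 0.
  by rewrite -wE -!mul_row_col mulmxA wM mul0mx.
move=> /matrixP/(_ 0 0); rewrite !mxE => /eqP.
rewrite psumr_eq0 => [/allP w0|j _]; last by rewrite mxE -expr2 sqr_ge0.
apply/rowP => j; have := w0 j (mem_index_enum _).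
by rewrite /= mxE -expr2 sqrf_eq0 mxE => /eqP.
Qed.

Lemma nonzero_column {R : realType} {a b : nat} (M : 'M[R]_(a, b)) :
  M <> 0 -> exists e : 'cV[R]_b, M *m e <> 0.
Proof.
move=> /eqP; rewrite -trmx_eq0 => /rowV0Pn[w /submxP[e wE] w0].
exists e^T => Me0; move: w0; rewrite wE -[M^T]trmxK.
by rewrite -trmx_eq0 trmx_mul !trmxK Me0 eqxx.
Qed.

Section Partitioned.
Context {R : realType} {nx k1 k2 r1 r2 : nat}.
Variables (C1 : 'M[R]_(r1, nx)) (C2 : 'M[R]_(r2, nx))
  (D11 : 'M[R]_(r1, k1)) (D12 : 'M[R]_(r1, k2))
  (D21 : 'M[R]_(r2, k1)) (D22 : 'M[R]_(r2, k2)).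
Local Notation C := (col_mx C1 C2).
Local Notation D := (block_mx D11 D12 D21 D22).

Lemma attains_none_sig_y1 : ~~ row_free (row_mx C1 (row_mx D11 D12)) ->
  attains_none C D (sig_y1 (k1 := k1) (k2 := k2) (r1 := r1) (r2 := r2)).
Proof.
move=> /not_row_free_not_onto[b bP]; exists b => x v.
rewrite /sig_y1 /sig_y col_mxKd -[v]vsubmxK mul_col_mx mul_block_col add_col_mx.
by rewrite col_mxKu; exact: bP.
Qed.

Lemma attains_none_sig_y2 : ~~ row_free (row_mx C2 (row_mx D21 D22)) ->
  attains_none C D (sig_y2 (k1 := k1) (k2 := k2) (r1 := r1) (r2 := r2)).
Proof.
move=> /not_row_free_not_onto[b bP]; exists b => x v.
rewrite /sig_y2 /sig_y col_mxKd -[v]vsubmxK mul_col_mx mul_block_col add_col_mx.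
by rewrite col_mxKd; exact: bP.
Qed.

Lemma attains_none_sig_y :
  attains_none C D (sig_y1 (k1 := k1) (k2 := k2) (r1 := r1) (r2 := r2)) ->
  attains_none C D (sig_y (k1 := k1) (k2 := k2) (r1 := r1) (r2 := r2)).
Proof.
move=> [b bP]; exists (col_mx b 0) => x v yE; apply: (bP x v).
by rewrite /sig_y1 yE col_mxKu.
Qed.

Lemma free_signal_sig_u : free_signal D (sig_u (k1 := k1) (k2 := k2) (r1 := r1) (r2 := r2)).
Proof. by move=> y b; exists b; rewrite /sig_u col_mxKu. Qed.

Lemma free_signal_sig_u1 : free_signal D (sig_u1 (k1 := k1) (k2 := k2) (r1 := r1) (r2 := r2)).
Proof. by move=> y b; exists (col_mx b 0); rewrite /sig_u1 /sig_u !col_mxKu. Qed.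

Lemma free_signal_sig_u2 : free_signal D (sig_u2 (k1 := k1) (k2 := k2) (r1 := r1) (r2 := r2)).
Proof. by move=> y b; exists (col_mx 0 b); rewrite /sig_u2 /sig_u col_mxKu col_mxKd. Qed.

(** [D22 <> 0] yields a nonzero direction of the second input, which moves [sig_u2] and leaves
    [sig_u1] fixed. *)
Lemma input_separates_u1_u2 : D22 <> 0 ->
  input_separates D (sig_u1 (k1 := k1) (k2 := k2) (r1 := r1) (r2 := r2)) sig_u2.
Proof.
move=> /nonzero_column[e e0]; exists (col_mx 0 e) => w.
rewrite /sig_u1 /sig_u2 /sig_u !linearD /= !col_mxKu col_mxKd addr0; split=> //.
move=> /eqP; rewrite addrC -subr_eq0 addrK => /eqP eE.
by apply: e0; rewrite eE mulmx0.
Qed.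

Lemma input_separates_u2_u1 : D11 <> 0 ->
  input_separates D (sig_u2 (k1 := k1) (k2 := k2) (r1 := r1) (r2 := r2)) sig_u1.
Proof.
move=> /nonzero_column[e e0]; exists (col_mx e 0) => w.
rewrite /sig_u1 /sig_u2 /sig_u !linearD /= !col_mxKu col_mxKd addr0; split=> //.
move=> /eqP; rewrite addrC -subr_eq0 addrK => /eqP eE.
by apply: e0; rewrite eE mulmx0.
Qed.

(** The hidden second input reaches the lower part of the output through [D22] without touching
    [sig_u1]. *)
Lemma input_separates_u1_y : D22 <> 0 ->
  input_separates D (sig_u1 (k1 := k1) (k2 := k2) (r1 := r1) (r2 := r2)) sig_y.
Proof.
move=> /nonzero_column[e e0]; exists (col_mx 0 e) => w.
rewrite /sig_u1 /sig_y /sig_u !linearD /= !col_mxKu col_mxKd addr0; split=> //.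
move=> /eqP; rewrite addrC -subr_eq0 addrK mul_block_col !mulmx0 !add0r => /eqP.
by move=> /(congr1 dsubmx); rewrite col_mxKd linear0.
Qed.

End Partitioned.

(** * Verification of the table *)

Theorem theorem3 (R : realType) (rel : relation) (nx k1 k2 r1 r2 : nat)
    (A : 'M[R]_nx) (B1 : 'M[R]_(nx, k1)) (B2 : 'M[R]_(nx, k2))
    (C1 : 'M[R]_(r1, nx)) (C2 : 'M[R]_(r2, nx))
    (D11 : 'M[R]_(r1, k1)) (D12 : 'M[R]_(r1, k2))
    (D21 : 'M[R]_(r2, k1)) (D22 : 'M[R]_(r2, k2))
    (n l T Tini : nat)
    (th : T.-tuple 'cV[R]_(theta_dim rel k1 k2 r1 r2))
    (ps : T.-tuple 'cV[R]_(psi_dim rel k1 k2 r1 r2)) :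
  let B := row_mx B1 B2 in
  let C := col_mx C1 C2 in
  let D := block_mx D11 D12 D21 D22 in
  is_order (behavior A B C D) n ->
  is_lag A C n l ->
  identifiable_at rel (behavior A B C D) n l th ps Tini ->
  D11 <> 0 ->
  D22 <> 0 ->
  ~~ row_free (row_mx C1 (row_mx D11 D12)) ->
  ~~ row_free (row_mx C2 (row_mx D21 D22)) ->
  becaus_correct rel th ps Tini.
Proof.
move=> B C D [repn _] [_ rkO _] ident D11n0 D22n0 nfree1 nfree2.
(* [D11] can be nonzero only if it has a column. *)
have k_gt0 : (0 < k1 + k2)%N.
  by case: k1 D11 D11n0 {B1 D21 th ps B D repn ident nfree1 nfree2} => [E []|//]; rewrite thinmx0.
have span := identifiable_hankel_spans k_gt0 repn ident.
have obs (x : 'cV_nx) : (forall i, (i < Tini)%N -> C *m (A ^+ i *m x) = 0) ->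
    forall i, (i < Tini + 2)%N -> C *m (A ^+ i *m x) = 0.
  by apply: observable_extension repn rkO _; apply: ltnW; case: ident.
have spanC := hankel_spansC span.
have y1_none := attains_none_sig_y1 C2 D21 D22 nfree1.
have y2_none := attains_none_sig_y2 C1 D11 D12 nfree2.
have y_none := attains_none_sig_y y1_none.
have iff_false (P : Prop) : ~ P -> P <-> false by move=> nP; split.
have iff_true (P : Prop) : P -> P <-> true by move=> p; split.
rewrite /becaus_correct.
(* Conditions ② and ④ become ① and ③ for the exchanged signals, where [spanC] applies; the 24 goals
   follow the table row by row. *)
case: rel th ps span spanC {ident} => th ps span spanC; split;
  rewrite ?cond2C ?cond4C; first [apply: iff_true | apply: iff_false].
- exact: cond1_input_separates span (input_separates_u1_u2 _ _ _ D22n0).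
- exact: cond1_input_separates spanC (input_separates_u2_u1 _ _ _ D11n0).
- exact: cond3_free_signal span (free_signal_sig_u2 _ _ _ _).
- exact: cond3_free_signal spanC (free_signal_sig_u1 _ _ _ _).
- exact: cond1_input_output obs span.
- exact: cond1_attains_none spanC y_none.
- exact: cond3_attains_none span y_none.
- exact: cond3_free_signal spanC (free_signal_sig_u _ _ _ _).
- exact: cond1_attains_none span y_none.
- exact: cond1_input_output obs spanC.
- exact: cond3_free_signal span (free_signal_sig_u _ _ _ _).
- exact: cond3_attains_none spanC y_none.
- exact: cond1_input_separates span (input_separates_u1_y _ _ _ D22n0).
- exact: cond1_attains_none spanC y_none.
- exact: cond3_attains_none span y_none.
- exact: cond3_free_signal spanC (free_signal_sig_u1 _ _ _ _).
- exact: cond1_attains_none span y_none.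
- exact: cond1_input_separates spanC (input_separates_u1_y _ _ _ D22n0).
- exact: cond3_free_signal span (free_signal_sig_u1 _ _ _ _).
- exact: cond3_attains_none spanC y_none.
- exact: cond1_attains_none span y1_none.
- exact: cond1_attains_none spanC y2_none.
- exact: cond3_attains_none span y2_none.
- exact: cond3_attains_none spanC y1_none.
Qed.
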